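(* Let $\Omega$ be a Polish space and $T\in\mathscr{L}(\mathscr{M}(\Omega),\sigma)$ with associated transition kernel $k$. Then the positive part $T^+$ of $T$ taken in the vector lattice $\mathscr{L}(\mathscr{M}(\Omega))$ is weakly continuous, and its associated transition kernel is $k_+$, i.e. $(T^+\mu)(A)=\int_\Omega k_+(x,A)\,d\mu(x)$. In particular, $\mathscr{L}(\mathscr{M}(\Omega),\sigma)$ is a sublattice of $\mathscr{L}(\mathscr{M}(\Omega))$.
   Context: $\mathscr{M}(\Omega)$ is the Banach lattice of finite signed Borel measures; $\mathscr{L}(\mathscr{M}(\Omega))$ is the Banach lattice of bounded operators on it, ordered by $S\le T$ iff $S\mu\le T\mu$ for all positive $\mu$. A transition kernel is a map $k:\Omega\times\mathscr{B}(\Omega)\to\mathbb{R}$, finite signed measure in the second variable and Borel measurable in the first; bounded if $\sup_x\lvert k\rvert(x,\Omega)<\infty$. $T$ is weakly continuous with associated kernel $k$ if $k$ is a bounded transition kernel and $(T\mu)(A)=\int k(x,A)\,d\mu(x)$ for all $\mu,A$; $\mathscr{L}(\mathscr{M}(\Omega),\sigma)$ denotes the space of weakly continuous operators. $k_+(x,\cdot)$ is the positive part of the signed measure $k(x,\cdot)$. *)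

(* Defs.v *)
From HB Require Import structures.
From mathcomp Require Import all_boot all_order all_algebra.
From mathcomp Require Import all_classical all_reals all_analysis.
From mathcomp Require Import measurable_realfun.
Set Implicit Arguments. Unset Strict Implicit. Unset Printing Implicit Defensive.
Import Order.TTheory GRing.Theory Num.Theory.
Import numFieldNormedType.Exports.
Local Open Scope classical_set_scope.
Local Open Scope ring_scope.

Definition polish_space (R : realType) (T : topologicalType) : Prop :=
  (exists D : set T, countable D /\ dense D) /\
  exists dist : T -> T -> R,
    [/\ (forall x y, dist x y = 0 <-> x = y),
        (forall x y, dist x y = dist y x),
        (forall x y z, dist x z <= dist x y + dist y z),
        (forall A : set T, open A <->
           (forall x, A x -> exists2 e : R, 0 < e & [set y | dist x y < e] `<=` A))
      & (forall u : nat -> T,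
           (forall e : R, 0 < e -> exists N : nat, forall m n : nat,
              (N <= m)%N -> (N <= n)%N -> dist (u m) (u n) < e) ->
           exists l : T, u @ \oo --> l)].

Notation borel T := (g_sigma_algebraType (@open T)).

Section measures_operators.
Context d (X : measurableType d) (R : realType).
Local Open Scope ereal_scope.

(** Elements of M(X): finite signed (countably additive) measures, represented
    by their values on measurable sets (library charges), normalized to 0 on
    non-measurable sets so that Leibniz equality is equality of measures. *)
Definition fsm (mu : set X -> \bar R) : Prop :=
  (exists nu : {charge set X -> \bar R}, forall A, measurable A -> mu A = nu A)
  /\ (forall A, ~ measurable A -> mu A = 0).

Definition madd (mu nu : set X -> \bar R) : set X -> \bar R :=
  fun A => mu A + nu A.
Definition mscale (r : R) (mu : set X -> \bar R) : set X -> \bar R :=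
  fun A => r%:E * mu A.
Definition mopp (mu : set X -> \bar R) : set X -> \bar R := fun A => - mu A.

(** Positive part of a signed measure (its supremum with 0 in M(X)):
    mu^+(A) = sup { mu(B) : B measurable, B ⊆ A }. *)
Definition mpos (mu : set X -> \bar R) : set X -> \bar R :=
  fun A => if `[< measurable A >] then
             ereal_sup [set mu B | B in [set B | measurable B /\ B `<=` A]]
           else 0.
Definition mneg (mu : set X -> \bar R) := mpos (mopp mu).

Definition tvnorm (mu : set X -> \bar R) : \bar R :=
  mpos mu setT + mneg mu setT.

Definition sintegral (mu : set X -> \bar R) (f : X -> \bar R) : \bar R :=
  \int[mpos mu]_(x in setT) f x - \int[mneg mu]_(x in setT) f x.

Definition positive_measure (mu : set X -> \bar R) : Prop :=
  fsm mu /\ forall A, measurable A -> 0 <= mu A.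

(** Operators on M(X) (only their action on elements of M(X) matters). *)
Definition op := (set X -> \bar R) -> (set X -> \bar R).

Definition bounded_op (T : op) : Prop :=
  [/\ (forall mu, fsm mu -> fsm (T mu)),
      (forall mu nu, fsm mu -> fsm nu -> T (madd mu nu) = madd (T mu) (T nu)),
      (forall (r : R) mu, fsm mu -> T (mscale r mu) = mscale r (T mu))
    & exists C : R, forall mu, fsm mu -> tvnorm (T mu) <= C%:E * tvnorm mu].

Definition op_le (S T : op) : Prop :=
  forall mu, positive_measure mu -> forall A, measurable A -> S mu A <= T mu A.

Definition op_zero : op := fun _ _ => 0.

Definition is_op_sup (S T P : op) : Prop :=
  [/\ bounded_op P, op_le S P, op_le T P
    & forall Q, bounded_op Q -> op_le S Q -> op_le T Q -> op_le P Q].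

Definition is_op_pos_part (T P : op) : Prop := is_op_sup T op_zero P.

Definition bounded_kernel (k : X -> set X -> \bar R) : Prop :=
  [/\ (forall x, fsm (k x)),
      (forall A, measurable A -> measurable_fun [set: X] ((fun x => k x A) : X -> \bar R))
    & exists M : R, forall x, tvnorm (k x) <= M%:E].

Definition weakly_continuous_with (T : op) (k : X -> set X -> \bar R) : Prop :=
  bounded_kernel k /\
  forall mu A, fsm mu -> measurable A -> T mu A = sintegral mu (fun x => k x A).

Definition weakly_continuous (T : op) : Prop :=
  exists k, weakly_continuous_with T k.

Definition kpos (k : X -> set X -> \bar R) : X -> set X -> \bar R :=
  fun x => mpos (k x).

End measures_operators.

(* Main.v *)
Require Import Defs.
From HB Require Import structures.
From mathcomp Require Import all_boot all_order all_algebra.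
From mathcomp Require Import all_classical all_reals all_analysis.
From mathcomp Require Import measurable_realfun.
From mathcomp Require Import lra.

Set Implicit Arguments.
Unset Strict Implicit.
Unset Printing Implicit Defensive.
Import Order.TTheory GRing.Theory Num.Theory.
Import numFieldNormedType.Exports.
Local Open Scope classical_set_scope.
Local Open Scope ring_scope.

(** The supremum of the operators with kernels k1 and k2 is the operator with
    kernel j := k2 + (k1 - k2)_+; the positive part is the case k2 = 0.
    The Borel sigma-algebra of a Polish space is countably generated, so there
    is a countable algebra (B_n) approximating every Borel set in every finite
    measure.  Hence, for each x, (k1 - k2)_+(x, A) is the limit of the running
    maxima of (k1 - k2)(x, A & B_n), which makes j measurable in x.  If Q
    dominates both operators and mu is positive, splitting mu along the set
    where the last term of a running maximum is the largest shows, by induction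
    on n, that the n-th maximum plus k2(x, A) integrates to at most Q mu A;
    dominated convergence gives j. *)

(** * Signed measures, their positive and negative parts, and total variation *)

Section signed_measures.
Context d (X : measurableType d) (R : realType).
Local Open Scope ereal_scope.
Implicit Types (mu nu : set X -> \bar R) (A B E : set X).

Lemma fsm_fin_num mu A : fsm mu -> mu A \is a fin_num.
Proof.
move=> [[nu muE] mu0]; have [mA|mA] := pselect (measurable A).
  by rewrite muE// fin_num_measure.
by rewrite mu0.
Qed.

Lemma mpos_measurable mu A : measurable A ->
  mpos mu A = ereal_sup [set mu B | B in [set B | measurable B /\ B `<=` A]].
Proof. by move=> mA; rewrite /mpos ifT//; apply/asboolP. Qed.

Lemma mpos_nonmeasurable mu A : ~ measurable A -> mpos mu A = 0.
Proof. by move=> mA; rewrite /mpos ifF//; apply/asboolP. Qed.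

Lemma mpos_ubound mu A B : measurable A -> measurable B -> B `<=` A ->
  mu B <= mpos mu A.
Proof.
by move=> mA mB BA; rewrite mpos_measurable//; apply: ereal_sup_ubound; exists B.
Qed.

(** A Hahn decomposition [P], [N] attains the suprema that define [mpos] and [mneg]: among the
    measurable subsets of [A], [mu] is largest on the trace of [A] on [P] and smallest on its trace
    on [N]. Hence integrals against [mpos mu] and [mneg mu] are integrals against finite
    measures. *)
Lemma fsm_jordan mu : fsm mu -> exists m1 m2 : {finite_measure set X -> \bar R},
  [/\ mpos mu = m1, mneg mu = m2 & forall A, measurable A -> mu A = m1 A - m2 A].
Proof.
move=> [[nu muE] mu0].
have [P [N nuPN]] := Hahn_decomposition nu.
have [[mP posP] [mN negN] PNT PN0] := nuPN.
have nuI A : measurable A -> nu A = nu (A `&` P) + nu (A `&` N).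
  move=> mA; rewrite -[in LHS](setIT A) -PNT setIUr chargeU//.
  - exact: measurableI.
  - exact: measurableI.
  - by rewrite setIACA PN0 setI0.
(* Split [nu B] along [P] and [N]: the part in [N] is nonpositive, and the part in [P] can only grow
   when [B] is enlarged to [A]. *)
have nuP A B : measurable A -> measurable B -> B `<=` A -> nu B <= nu (A `&` P).
  move=> mA mB BA; rewrite (nuI _ mB) -[leRHS]adde0; apply: leeD; last first.
    by apply: negN; [exact: measurableI|exact: subIsetr].
  rewrite -[in leRHS](@setDUK _ (B `&` P) (A `&` P)); last exact: setSI.
  rewrite chargeU//; first 1 last.
  - exact: measurableI.
  - by apply: measurableD; exact: measurableI.
  - by rewrite setDIK.
  rewrite leeDl//; apply: posP.
    by apply: measurableD; exact: measurableI.
  by move=> x [[]].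
have nuN A B : measurable A -> measurable B -> B `<=` A -> nu (A `&` N) <= nu B.
  move=> mA mB BA; rewrite (nuI _ mB) -[leLHS]add0e; apply: leeD.
    by apply: posP; [exact: measurableI|exact: subIsetr].
  rewrite -[in leLHS](@setDUK _ (B `&` N) (A `&` N)); last exact: setSI.
  rewrite chargeU//; first 1 last.
  - exact: measurableI.
  - by apply: measurableD; exact: measurableI.
  - by rewrite setDIK.
  rewrite geeDl//; apply: negN.
    by apply: measurableD; exact: measurableI.
  by move=> x [[]].
exists (jordan_pos nuPN), (jordan_neg nuPN); split.
- apply/funext => A; rewrite [RHS]jordan_posE cjordan_posE /crestr0 /crestr.
  have [mA|mA] := pselect (measurable A); last first.
    by rewrite mpos_nonmeasurable// memNset.
  rewrite mem_set// mpos_measurable//; apply/eqP; rewrite eq_le; apply/andP; split.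
    by apply: ge_ereal_sup => _ [B [mB BA] <-]; rewrite muE//; exact: nuP.
  have mAP : measurable (A `&` P) by exact: measurableI.
  by apply: ereal_sup_ubound; exists (A `&` P); rewrite ?muE//; split.
- apply/funext => A; rewrite [RHS]jordan_negE cjordan_negE /crestr0 /crestr /mneg.
  have [mA|mA] := pselect (measurable A); last first.
    by rewrite mpos_nonmeasurable// memNset// oppe0.
  rewrite mem_set// mpos_measurable//; apply/eqP; rewrite eq_le; apply/andP; split.
    apply: ge_ereal_sup => _ [B [mB BA] <-].
    by rewrite /mopp muE// leeN2; exact: nuN.
  have mAP : measurable (A `&` N) by exact: measurableI.
  by apply: ereal_sup_ubound; exists (A `&` N); rewrite /mopp ?muE//; split.
- move=> A mA; rewrite muE// nuI//.
  rewrite [X in _ = _ - X](_ : _ = - crestr0 nu mN A); last exact: cjordan_negE.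
  rewrite [X in _ = X - _](_ : _ = crestr0 nu mP A)//.
  by rewrite /crestr0 /crestr mem_set// oppeK.
Qed.

Lemma mpos_id mu : positive_measure mu -> mpos mu = mu.
Proof.
move=> [fmu mu0]; apply/funext => A; have [mA|mA] := pselect (measurable A).
  apply/eqP; rewrite eq_le mpos_ubound// andbT mpos_measurable//.
  apply: ge_ereal_sup => _ [B [mB BA] <-].
  case: fmu => [[nu muE] _]; rewrite !muE//.
  rewrite -[in leRHS](setDUK BA) chargeU//; last by rewrite setDIK.
    by rewrite leeDl// -muE; [apply: mu0|]; exact: measurableD.
  exact: measurableD.
by rewrite mpos_nonmeasurable// (proj2 fmu).
Qed.

Lemma mneg_id mu : positive_measure mu -> mneg mu = fun=> 0.
Proof.
move=> [fmu mu0]; apply/funext => A; have [mA|mA] := pselect (measurable A).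
  apply/eqP; rewrite eq_le /mneg; apply/andP; split.
    rewrite mpos_measurable//; apply: ge_ereal_sup => _ [B [mB BA] <-].
    by rewrite /mopp leeNl oppe0 mu0.
  apply: (@le_trans _ _ (mopp mu set0)); last exact: mpos_ubound.
  by case: fmu => [[nu muE] _]; rewrite /mopp muE// charge0 oppe0.
by rewrite /mneg mpos_nonmeasurable.
Qed.

Lemma positive_measureP mu : positive_measure mu ->
  exists m : {finite_measure set X -> \bar R}, mu = m.
Proof.
move=> pmu; have [fmu _] := pmu; have [m1 [_ [+ _ _]]] := fsm_jordan fmu.
by rewrite mpos_id// => ->; exists m1.
Qed.

(** The value 0 is imposed on non-measurable [A] because [fsm] asks for it, while the intersection
    of [A] with [E] may still be measurable. *)
Definition mrestrict0 E mu : set X -> \bar R :=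
  fun A => if `[< measurable A >] then mu (A `&` E) else 0.

Lemma mrestrict0E E mu A : measurable A -> mrestrict0 E mu A = mu (A `&` E).
Proof. by move=> mA; rewrite /mrestrict0 asboolT. Qed.

Lemma positive_mrestrict0 E mu : measurable E ->
  positive_measure mu -> positive_measure (mrestrict0 E mu).
Proof.
move=> mE [[[nu muE] _] mu0]; split; last first.
  by move=> A mA; rewrite mrestrict0E// mu0//; exact: measurableI.
split; last by move=> A mA; rewrite /mrestrict0 asboolF.
exists (crestr nu mE : {charge set X -> \bar R}) => A mA.
by rewrite mrestrict0E// muE//; exact: measurableI.
Qed.

Lemma madd_mrestrict0 E mu : measurable E -> fsm mu ->
  madd (mrestrict0 E mu) (mrestrict0 (~` E) mu) = mu.
Proof.
move=> mE [[nu muE] mu0]; apply/funext => A; rewrite /madd.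
have [mA|mA] := pselect (measurable A); last first.
  by rewrite /mrestrict0 asboolF// mu0// adde0.
have mEC := measurableC mE.
rewrite !mrestrict0E// !muE//; first 1 last.
- exact: measurableI.
- exact: measurableI.
by rewrite -setDE addeC -chargeDI.
Qed.

Lemma fsm_madd mu nu : fsm mu -> fsm nu -> fsm (madd mu nu).
Proof.
move=> [[m1 muE] mu0] [[m2 nuE] nu0]; split; last first.
  by move=> A mA; rewrite /madd mu0// nu0// adde0.
by exists (cadd m1 m2 : {charge set X -> \bar R}) => A mA;
  rewrite /madd muE// nuE.
Qed.

Lemma fsm_mscale (r : R) mu : fsm mu -> fsm (Defs.mscale r mu).
Proof.
move=> [[m muE] mu0]; split; last first.
  by move=> A mA; rewrite /Defs.mscale mu0// mule0.
exists (cscale r m : {charge set X -> \bar R}) => A mA.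
by rewrite /Defs.mscale muE.
Qed.

Lemma fsm_mopp mu : fsm mu -> fsm (mopp mu).
Proof.
move=> [[m muE] mu0]; split; last first.
  by move=> A mA; rewrite /mopp mu0// oppe0.
by exists (copp m : {charge set X -> \bar R}) => A mA; rewrite /mopp muE.
Qed.

Lemma fsm_mpos mu : fsm mu -> fsm (mpos mu).
Proof.
move=> fmu; have [m1 [_ [m1E _ _]]] := fsm_jordan fmu; split.
  exists (charge_of_finite_measure m1 : {charge set X -> \bar R}) => A mA.
  by rewrite m1E.
by move=> A mA; rewrite mpos_nonmeasurable.
Qed.

Lemma abse_le_tvnorm mu B : fsm mu -> measurable B -> `|mu B| <= tvnorm mu.
Proof.
move=> fmu mB; have [m1 [m2 [m1E m2E muE]]] := fsm_jordan fmu.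
have ? := measure_ge0 m1 B; have ? := measure_ge0 m2 B.
rewrite /tvnorm m1E m2E muE//; apply: (le_trans (lee_abs_sub _ _)).
by rewrite !gee0_abs//; apply: leeD; apply: le_measure; rewrite ?inE.
Qed.

(** The positive and the negative part each have total mass at most [M]. Together with
    [abse_le_tvnorm], this exchanges bounds on [tvnorm] for uniform bounds on values, up to a factor
    2. *)
Lemma tvnorm_le mu (M : \bar R) :
  (forall B, measurable B -> `|mu B| <= M) -> tvnorm mu <= M + M.
Proof.
move=> muM; rewrite /tvnorm /mneg !mpos_measurable//; apply: leeD.
  apply: ge_ereal_sup => _ [B [mB _] <-].
  exact: le_trans (lee_abs _) (muM _ mB).
apply: ge_ereal_sup => _ [B [mB _] <-].
by rewrite /mopp; apply: (le_trans (lee_abs _)); rewrite abseN; exact: muM.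
Qed.

End signed_measures.

(** * Integrals of bounded measurable functions against signed measures *)

Section integration.
Context d (X : measurableType d) (R : realType).
Local Open Scope ereal_scope.
Implicit Types (mu nu : set X -> \bar R) (A B E : set X) (f g : X -> \bar R).

Lemma fin_numEX (x : \bar R) : x \is a fin_num -> exists r : R, x = r%:E.
Proof. by move=> xfin; exists (fine x); rewrite fineK. Qed.

Lemma finite_measureP (m : {measure set X -> \bar R}) : fin_num_fun m ->
  exists m' : {finite_measure set X -> \bar R},
    (m : set X -> \bar R) = (m' : set X -> \bar R).
Proof.
move=> mfin; have mT : m setT < +oo by rewrite ltey_eq mfin.
exists (mfrestr measurableT mT); apply/funext => A.
by rewrite /= /mfrestr /mrestr setIT.
Qed.

Lemma finite_measure_add (m m' : {finite_measure set X -> \bar R}) :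
  exists q : {finite_measure set X -> \bar R}, forall A, q A = m A + m' A.
Proof.
have [|q qE] := @finite_measureP (measure_add m m').
  move=> A mA; rewrite [X in X \is a _](measure_addE m m' A).
  by rewrite fin_numD !fin_num_measure.
by exists q => A; rewrite -qE; exact: measure_addE.
Qed.

Lemma bounded_integrable (m : {finite_measure set X -> \bar R}) f (M : R) :
  measurable_fun setT f -> (forall x, `|f x| <= M%:E) ->
  m.-integrable setT f.
Proof.
move=> mf fM; apply: (le_integrable measurableT mf _
  (finite_measure_integrable_cst m M measurableT)) => x _ /=.
by apply: (le_trans (fM x)); rewrite lee_fin ler_norm.
Qed.

Lemma abse_integral_le (m : {finite_measure set X -> \bar R}) f (M : R) :
  measurable_fun setT f -> (forall x, `|f x| <= M%:E) ->
  `|\int[m]_x f x| <= M%:E * m setT.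
Proof.
move=> mf fM; apply: (le_trans (le_abse_integral _ _ _)) => //.
rewrite -integral_cst//; apply: ge0_le_integral => //.
exact: measurableT_comp.
Qed.

Lemma integral_fin_num (m : {finite_measure set X -> \bar R}) f (M : R) :
  measurable_fun setT f -> (forall x, `|f x| <= M%:E) ->
  \int[m]_x f x \is a fin_num.
Proof.
by move=> mf fM; apply: integrable_fin_num => //; exact: bounded_integrable fM.
Qed.

Lemma integral_madd (m m1 m2 : {finite_measure set X -> \bar R}) f (M : R) :
  measurable_fun setT f -> (forall x, `|f x| <= M%:E) ->
  (forall A, measurable A -> m A = m1 A + m2 A) ->
  \int[m]_x f x = \int[m1]_x f x + \int[m2]_x f x.
Proof.
move=> mf fM mE.
rewrite -integral_measure_add//; [|exact: bounded_integrable fM..].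
apply: eq_measure_integral => A mA _.
by rewrite [RHS]measure_addE; exact: mE.
Qed.

Lemma integral_mscale (m m1 : {finite_measure set X -> \bar R}) f (M r : R) :
  (0 <= r)%R ->
  measurable_fun setT f -> (forall x, `|f x| <= M%:E) ->
  (forall A, measurable A -> m A = r%:E * m1 A) ->
  \int[m]_x f x = r%:E * \int[m1]_x f x.
Proof.
move=> r0 mf fM mE.
have -> : \int[m]_x f x = \int[mscale (NngNum r0) m1]_x f x.
  by apply: eq_measure_integral => A mA _; exact: mE.
rewrite integralE [in RHS]integralE.
rewrite !ge0_integral_mscale//=; [|exact: measurable_funeneg|exact: measurable_funepos].
rewrite [RHS]muleBr//; apply: fin_num_adde_defl; rewrite fin_numN.
apply: integrable_fin_num => //.
exact/integrable_funeneg/(bounded_integrable _ mf fM).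
Qed.

Lemma sintegralE mu f :
  Defs.sintegral mu f = \int[mpos mu]_x f x - \int[mneg mu]_x f x.
Proof. by []. Qed.

(** If [p - n = m1 - m2], then [p + m2 = n + m1] is an equality of positive measures, whose
    integrals add. Linearity in [mu] rests on this freedom of representation, since the Jordan parts
    of a sum are in general not the sums of the Jordan parts. *)
Lemma sintegral_sub mu (m1 m2 : {finite_measure set X -> \bar R}) f (M : R) :
  fsm mu -> measurable_fun setT f -> (forall x, `|f x| <= M%:E) ->
  (forall A, measurable A -> mu A = m1 A - m2 A) ->
  Defs.sintegral mu f = \int[m1]_x f x - \int[m2]_x f x.
Proof.
move=> fmu mf fM muE; have [p [n [pE nE mupn]]] := fsm_jordan fmu.
have fin m : \int[m : {finite_measure set X -> \bar R}]_x f x \is a fin_num.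
  exact: integral_fin_num fM.
have : \int[p]_x f x + \int[m2]_x f x = \int[n]_x f x + \int[m1]_x f x.
  rewrite -!integral_measure_add//; [|exact: bounded_integrable fM..].
  apply: eq_measure_integral => A mA _; rewrite [RHS]measure_addE.
  rewrite [LHS]measure_addE /=.
  have := muE _ mA; rewrite (mupn _ mA).
  have [a ->] := fin_numEX (fin_num_measure p A mA).
  have [b ->] := fin_numEX (fin_num_measure n A mA).
  have [c ->] := fin_numEX (fin_num_measure m1 A mA).
  have [e ->] := fin_numEX (fin_num_measure m2 A mA).
  by rewrite -!EFinB -!EFinD => -[] h; congr EFin; lra.
rewrite sintegralE pE nE.
have [a ->] := fin_numEX (fin p).
have [b ->] := fin_numEX (fin n).
have [c ->] := fin_numEX (fin m1).
have [e ->] := fin_numEX (fin m2).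
by rewrite -!EFinB -!EFinD => -[] h; congr EFin; lra.
Qed.

Lemma sintegral_positive (m : {finite_measure set X -> \bar R}) f :
  positive_measure m -> Defs.sintegral m f = \int[m]_x f x.
Proof.
move=> pm; rewrite sintegralE mpos_id// mneg_id//.
have -> : \int[fun=> 0]_x f x = \int[@mzero _ X R]_x f x by [].
by rewrite integral_measure_zero sube0.
Qed.

Lemma sintegral_madd mu nu f (M : R) : fsm mu -> fsm nu ->
  measurable_fun setT f -> (forall x, `|f x| <= M%:E) ->
  Defs.sintegral (madd mu nu) f = Defs.sintegral mu f + Defs.sintegral nu f.
Proof.
move=> fmu fnu mf fM.
have [p [n [pE nE mupn]]] := fsm_jordan fmu.
have [p' [n' [p'E n'E nupn]]] := fsm_jordan fnu.
have fin m : \int[m : {finite_measure set X -> \bar R}]_x f x \is a fin_num.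
  exact: integral_fin_num fM.
(* [q - q'] represents the sum, although it need not be its Jordan decomposition. *)
have [q qE] := finite_measure_add p p'.
have [q' q'E] := finite_measure_add n n'.
rewrite (@sintegral_sub _ q q' f M)//; first 1 last.
- exact: fsm_madd.
- move=> A mA; rewrite /madd mupn// nupn//.
  rewrite qE q'E.
  have [a ->] := fin_numEX (fin_num_measure p A mA).
  have [b ->] := fin_numEX (fin_num_measure n A mA).
  have [c ->] := fin_numEX (fin_num_measure p' A mA).
  have [e ->] := fin_numEX (fin_num_measure n' A mA).
  by rewrite -!EFinB -!EFinD; congr EFin; lra.
rewrite (@integral_madd q p p' f M)// (@integral_madd q' n n' f M)//.
rewrite !sintegralE pE nE p'E n'E.
have [a ->] := fin_numEX (fin p).
have [b ->] := fin_numEX (fin n).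
have [c ->] := fin_numEX (fin p').
have [e ->] := fin_numEX (fin n').
by rewrite -!EFinB -!EFinD; congr EFin; lra.
Qed.

Lemma sintegral_mscale (r : R) mu f (M : R) : fsm mu ->
  measurable_fun setT f -> (forall x, `|f x| <= M%:E) ->
  Defs.sintegral (Defs.mscale r mu) f = r%:E * Defs.sintegral mu f.
Proof.
move=> fmu mf fM; have [p [n [pE nE mupn]]] := fsm_jordan fmu.
have fin m : \int[m : {finite_measure set X -> \bar R}]_x f x \is a fin_num.
  exact: integral_fin_num fM.
have scaleE (m : {finite_measure set X -> \bar R}) :
    exists q : {finite_measure set X -> \bar R}, forall A, q A = `|r|%:E * m A.
  have [|q qE] := @finite_measureP (mscale (NngNum (normr_ge0 r)) m).
    by move=> A mA; rewrite /mscale/= fin_numM// fin_num_measure.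
  by exists q => A; rewrite -qE.
have [q qE] := scaleE p; have [q' q'E] := scaleE n.
have fs := fsm_mscale r fmu.
have qI := @integral_mscale q p f M _ (normr_ge0 r) mf fM (fun A _ => qE A).
have q'I := @integral_mscale q' n f M _ (normr_ge0 r) mf fM (fun A _ => q'E A).
have [r0|r0] := leP 0%R r.
  rewrite (@sintegral_sub _ q q' f M)//; last first.
    move=> A mA; rewrite /Defs.mscale mupn// qE q'E ger0_norm// [LHS]muleBr//.
    by apply: fin_num_adde_defr; rewrite fin_num_measure.
  rewrite qI q'I sintegralE pE nE ger0_norm// [RHS]muleBr//.
  by apply: fin_num_adde_defr; rewrite fin.
(* For negative [r] the two parts change roles: the scaled measure is [|r| n - |r| p]. *)
rewrite (@sintegral_sub _ q' q f M)//; last first.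
  move=> A mA; rewrite /Defs.mscale mupn// qE q'E ltr0_norm//.
  have [a ->] := fin_numEX (fin_num_measure p A mA).
  have [b ->] := fin_numEX (fin_num_measure n A mA).
  by rewrite -!EFinM -!EFinB; congr EFin; lra.
rewrite qI q'I sintegralE pE nE ltr0_norm//.
have [a ->] := fin_numEX (fin p).
have [b ->] := fin_numEX (fin n).
by rewrite -!EFinM -!EFinB; congr EFin; lra.
Qed.

End integration.

(** * Bounded kernels and the operators that they induce *)

Section kernel_operators.
Context d (X : measurableType d) (R : realType).
Local Open Scope ereal_scope.
Implicit Types (mu nu : set X -> \bar R) (A B E : set X) (f g : X -> \bar R).
Implicit Types (k : X -> set X -> \bar R).

Lemma chargeP nu : nu set0 = 0 ->
  (forall A, measurable A -> nu A \is a fin_num) -> semi_sigma_additive nu ->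
  exists c : {charge set X -> \bar R}, nu = c.
Proof.
move=> nu0 nufin nus.
pose c : {charge set X -> \bar R} :=
  HB.pack nu (isCharge.Build _ _ _ nu nu0 nufin nus).
by exists c.
Qed.

Lemma sintegralD mu f g (M N : R) : fsm mu ->
  measurable_fun setT f -> (forall x, `|f x| <= M%:E) ->
  measurable_fun setT g -> (forall x, `|g x| <= N%:E) ->
  Defs.sintegral mu (f \+ g) = Defs.sintegral mu f + Defs.sintegral mu g.
Proof.
move=> fmu mf fM mg gN; have [p [n [pE nE _]]] := fsm_jordan fmu.
rewrite !sintegralE pE nE !integralD//; first 1 last.
- exact: bounded_integrable fM.
- exact: bounded_integrable gN.
- exact: bounded_integrable fM.
- exact: bounded_integrable gN.
have [a ->] := fin_numEX (integral_fin_num p mf fM).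
have [b ->] := fin_numEX (integral_fin_num n mf fM).
have [c ->] := fin_numEX (integral_fin_num p mg gN).
have [e ->] := fin_numEX (integral_fin_num n mg gN).
by rewrite -!EFinD; congr EFin; lra.
Qed.

Lemma abse_sintegral_le mu f (M : R) : fsm mu ->
  measurable_fun setT f -> (forall x, `|f x| <= M%:E) ->
  `|Defs.sintegral mu f| <= M%:E * tvnorm mu.
Proof.
move=> fmu mf fM; have [p [n [pE nE _]]] := fsm_jordan fmu.
rewrite sintegralE /tvnorm pE nE; apply: (le_trans (lee_abs_sub _ _)).
rewrite muleDr//; last by rewrite ge0_adde_def// inE.
by apply: leeD; exact: abse_integral_le.
Qed.

Lemma sintegral_fin_num mu f (M : R) : fsm mu ->
  measurable_fun setT f -> (forall x, `|f x| <= M%:E) ->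
  Defs.sintegral mu f \is a fin_num.
Proof.
move=> fmu mf fM; have [p [n [pE nE _]]] := fsm_jordan fmu.
rewrite sintegralE pE nE fin_numB.
by rewrite (integral_fin_num p mf fM) (integral_fin_num n mf fM).
Qed.

(** Dominated convergence on each Jordan part; the constant [M] is an integrable bound because both
    parts are finite. *)
Lemma cvg_sintegral mu (f_ : nat -> X -> \bar R) f (M : R) : fsm mu ->
  (forall n, measurable_fun setT (f_ n)) -> measurable_fun setT f ->
  (forall n x, `|f_ n x| <= M%:E) ->
  (forall x, f_ ^~ x @ \oo --> f x) ->
  Defs.sintegral mu (f_ n) @[n --> \oo] --> Defs.sintegral mu f.
Proof.
move=> fmu mf_ mf fM ff; have [p [n [pE nE _]]] := fsm_jordan fmu.
have fcvg (m : {finite_measure set X -> \bar R}) :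
    m.-integrable setT f /\ \int[m]_x f_ n x @[n --> \oo] --> \int[m]_x f x.
  have [] // := @dominated_convergence _ _ _ m _ measurableT f_ f (cst M%:E).
  - exact: aeW.
  - exact: finite_measure_integrable_cst.
  - by apply: aeW.
under eq_fun do rewrite sintegralE pE nE; rewrite sintegralE pE nE.
apply: cvgeB; [|exact: (fcvg p).2|exact: (fcvg n).2].
by apply: fin_num_adde_defr; apply: integrable_fin_num (fcvg p).1.
Qed.

Lemma bounded_kernel_le k : bounded_kernel k ->
  exists M : R, forall A, measurable A -> forall x, `|k x A| <= M%:E.
Proof.
move=> [fk _ [M kM]]; exists M => A mA x.
exact: le_trans (abse_le_tvnorm (fk x) mA) (kM x).
Qed.

Lemma bounded_kernel_intro k (M : R) : (forall x, fsm (k x)) ->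
  (forall A, measurable A -> measurable_fun setT (k ^~ A)) ->
  (forall x A, measurable A -> `|k x A| <= M%:E) -> bounded_kernel k.
Proof.
move=> fk mk kM; split => //; exists (M + M)%R => x.
by rewrite EFinD; apply: tvnorm_le => B; exact: kM.
Qed.

(** The value 0 on non-measurable sets makes the image satisfy the normalization in [fsm]. *)
Definition kernel_op k : op X R := fun mu A =>
  if `[< measurable A >] then Defs.sintegral mu (k ^~ A) else 0.

Lemma kernel_opE k mu A : measurable A ->
  kernel_op k mu A = Defs.sintegral mu (k ^~ A).
Proof. by move=> mA; rewrite /kernel_op asboolT. Qed.

(** Countable additivity is inherited from the kernel: the partial sums are the integrals of
    [k x (S n)], which converge pointwise to the value at the whole union and are bounded uniformly
    in [n] and [x]. *)
Lemma fsm_kernel_op k mu : bounded_kernel k -> fsm mu -> fsm (kernel_op k mu).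
Proof.
move=> bk fmu; have [M kM] := bounded_kernel_le bk; have [fk mk _] := bk.
split; last by move=> A mA; rewrite /kernel_op asboolF.
suff [c cE] : exists c : {charge set X -> \bar R}, kernel_op k mu = c.
  by exists c => A _; rewrite cE.
have k0 x : k x set0 = 0.
  by have [[nu kE] _] := fk x; rewrite kE// charge0.
have kop0 : kernel_op k mu set0 = 0.
  rewrite kernel_opE//; under [k ^~ set0]eq_fun do rewrite k0.
  have [p [n [pE nE _]]] := fsm_jordan fmu.
  by rewrite sintegralE pE nE !integral0_eq// sube0.
apply: chargeP => //.
  by move=> A mA; rewrite kernel_opE//; apply: sintegral_fin_num (kM _ mA) => //; exact: mk.
move=> F mF tF mU; rewrite kernel_opE//.
pose S n := \big[setU/set0]_(i < n) F i.
have mS n : measurable (S n) by exact: bigsetU_measurable.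
have SF n : S n `&` F n = set0.
  apply/eqP/negPn/negP => /set0P[x []]; rewrite /S -bigcup_mkord => -[i/= ni Fi] Fn.
  by move: ni; rewrite (tF i n)// ?ltnn//; exists x.
have kS x n : \sum_(0 <= i < n) k x (F i) = k x (S n).
  elim: n => [|n ih]; first by rewrite big_geq// /S big_ord0 k0.
  rewrite big_nat_recr//= ih /S big_ord_recr /= -/(S n).
  by have [[nu kE] _] := fk x; rewrite !kE//; [rewrite chargeU//|exact: measurableU].
have -> : (fun n => \sum_(0 <= i < n) kernel_op k mu (F i)) =
    (fun n => Defs.sintegral mu (k ^~ (S n))).
  apply/funext; elim => [|n ih].
    by rewrite big_geq// /S big_ord0 -kernel_opE.
  rewrite big_nat_recr//= ih kernel_opE// -(sintegralD fmu _ (kM _ _) _ (kM _ _))//; [|exact: mk..].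
  congr Defs.sintegral; apply/funext => x /=.
  by rewrite -!kS big_nat_recr.
apply: (cvg_sintegral fmu _ _ (fun n => kM _ (mS n))).
- by move=> n; exact: mk.
- exact: mk.
- move=> x; have [[nu kE] _] := fk x.
  have -> : (fun n => k x (S n)) = (fun n => \sum_(0 <= i < n) nu (F i)).
    by apply/funext => n; rewrite -kS; apply: eq_bigr => i _; rewrite kE.
  by rewrite kE//; exact: charge_semi_sigma_additive.
Qed.

Lemma kernel_op_bounded k : bounded_kernel k -> bounded_op (kernel_op k).
Proof.
move=> bk; have [M kM] := bounded_kernel_le bk; have [fk mk _] := bk; split.
- by move=> mu; exact: fsm_kernel_op.
- move=> mu nu fmu fnu; apply/funext => A; rewrite /madd.
  have [mA|mA] := pselect (measurable A); last by rewrite /kernel_op asboolF// adde0.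
  by rewrite !kernel_opE// (sintegral_madd fmu fnu _ (kM _ mA))//; exact: mk.
- move=> r mu fmu; apply/funext => A; rewrite /Defs.mscale.
  have [mA|mA] := pselect (measurable A); last by rewrite /kernel_op asboolF// mule0.
  by rewrite !kernel_opE// (sintegral_mscale _ fmu _ (kM _ mA))//; exact: mk.
- exists (M + M)%R => mu fmu.
  have [p [n [pE nE _]]] := fsm_jordan fmu.
  (* This form matches [tvnorm_le], with [M * tvnorm mu] as the bound on the values of the image
     measure. *)
  have -> : (M + M)%:E * tvnorm mu = M%:E * tvnorm mu + M%:E * tvnorm mu.
    rewrite /tvnorm pE nE.
    have [a ->] := fin_numEX (fin_num_measure p _ measurableT).
    have [b ->] := fin_numEX (fin_num_measure n _ measurableT).
    by rewrite -!EFinD -!EFinM; congr EFin; lra.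
  apply: tvnorm_le => B mB; rewrite kernel_opE//.
  by apply: abse_sintegral_le => //; [exact: mk|exact: kM].
Qed.

Lemma kernel_op_weakly_continuous k : bounded_kernel k ->
  weakly_continuous_with (kernel_op k) k.
Proof. by move=> bk; split => // mu A _ mA; rewrite kernel_opE. Qed.

End kernel_operators.

(** * Countable approximating families and running maxima *)

Section countably_generated.
Context d (X : measurableType d) (R : realType).
Local Open Scope ereal_scope.
Implicit Types (mu nu : set X -> \bar R) (A B E : set X).

(* Trees encode NOR-expressions in the G n, so the range is the Boolean algebra
   generated by G; GenTree.tree nat is a countType, hence it is countable. *)
Fixpoint nor_algebra (G : nat -> set X) (t : GenTree.tree nat) : set X :=
  match t with
  | GenTree.Leaf n => G n
  | GenTree.Node _ (t1 :: t2 :: _) =>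
      ~` (nor_algebra G t1 `|` nor_algebra G t2)
  | _ => set0
  end.

Lemma measurable_nor_algebra (G : nat -> set X) :
  (forall n, measurable (G n)) -> forall t, measurable (nor_algebra G t).
Proof.
move=> mG; fix IH 1 => -[n|n [|t1 [|t2 s]]] //=.
by apply: measurableC; apply: measurableU; exact: IH.
Qed.

Definition symdiff A B := (A `\` B) `|` (B `\` A).

Lemma measurable_symdiff A B :
  measurable A -> measurable B -> measurable (symdiff A B).
Proof. by move=> mA mB; apply: measurableU; exact: measurableD. Qed.

(** The sequence is chosen before the measure: one sequence has to serve all the measures [k x]
    simultaneously. *)
Definition approximating (B : nat -> set X) :=
  (forall n, measurable (B n)) /\
  forall (m : {finite_measure set X -> \bar R}) A, measurable A ->
  forall e : R, (0 < e)%R -> exists n, m (symdiff A (B n)) < e%:E.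

Section approximation.
Variables (G : nat -> set X) (m : {finite_measure set X -> \bar R}).
Hypothesis mG : forall n, measurable (G n).

(** The good sets: they are shown to form a sigma-algebra containing every [G n], hence to include
    the generated one. *)
Let approx A := measurable A /\
  forall e : R, (0 < e)%R -> exists t, m (symdiff A (nor_algebra G t)) < e%:E.

(** The symmetric difference of two NORs lies in the union of the symmetric differences of their
    arguments, each of which gets half of the error. *)
Let approx_nor A B : approx A -> approx B -> approx (~` (A `|` B)).
Proof.
move=> [mA aA] [mB aB]; split; first exact/measurableC/measurableU.
move=> e e0; have e20 : (0 < e / 2)%R by rewrite divr_gt0.
have [s sA] := aA _ e20; have [t tB] := aB _ e20.
exists (GenTree.Node 0 [:: s; t]) => /=.
have mS := measurable_nor_algebra mG s; have mT := measurable_nor_algebra mG t.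
apply: (@le_lt_trans _ _ (m (symdiff A (nor_algebra G s) `|`
    symdiff B (nor_algebra G t)))).
  apply: le_measure; rewrite ?inE.
  - by apply: measurable_symdiff; exact/measurableC/measurableU.
  - by apply: measurableU; exact: measurable_symdiff.
  - rewrite /symdiff => x /=.
    have := pselect (A x); have := pselect (B x).
    have := pselect (nor_algebra G s x); have := pselect (nor_algebra G t x).
    tauto.
apply: (le_lt_trans (measureU2 _ _ _)); [exact: measurable_symdiff..|].
by rewrite (splitr e) EFinD lteD.
Qed.

Let approxC A : approx A -> approx (~` A).
Proof. by move=> aA; rewrite -[A]setUid; exact: approx_nor. Qed.

Let approxU A B : approx A -> approx B -> approx (A `|` B).
Proof. by move=> aA aB; rewrite -[_ `|` _]setCK; exact/approxC/approx_nor. Qed.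

Let approx0 : approx set0.
Proof.
split => // e e0; exists (GenTree.Node 0 [::]) => /=.
by rewrite /symdiff setDv setU0 measure0.
Qed.

(** By continuity from below some finite union [S n] misses less than [e / 2] of the whole union; as
    a good set, [S n] is itself within [e / 2] of a member of the algebra. *)
Let approx_bigcup (F : nat -> set X) :
  (forall n, approx (F n)) -> approx (\bigcup_n F n).
Proof.
move=> aF; pose S n := \big[setU/set0]_(i < n.+1) F i.
have aS n : approx (S n).
  elim: n => [|n ih]; first by rewrite /S big_ord_recr big_ord0 /= set0U.
  by rewrite /S big_ord_recr /=; exact: approxU.
have mU : measurable (\bigcup_n F n) by apply: bigcup_measurable => n _; exact: (aF n).1.
split=> // e e0; have e20 : (0 < e / 2)%R by rewrite divr_gt0.
have SU n : S n `<=` \bigcup_n F n.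
  by rewrite /S -bigcup_mkord => x [i _ Fi]; exists i.
have [n nU] : exists n, m ((\bigcup_n F n) `\` S n) < (e / 2)%:E.
  have finU := fin_num_measure m _ mU.
  have /fine_cvgP[_] : m (S n) @[n --> \oo] --> (fine (m (\bigcup_n F n)))%:E.
    rewrite fineK//; have -> : \bigcup_n F n = \bigcup_n S n.
      by rewrite /S; exact/esym/bigcup_bigsetU_bigcup.
    apply: nondecreasing_cvg_mu.
    - by move=> n; exact: (aS n).1.
    - by apply: bigcup_measurable => n _; exact: (aS n).1.
    - by move=> i j ij; apply/subsetPset; exact: subset_bigsetU.
  move=> /cvgrPdist_lt/(_ _ e20)[n _ /(_ n (leqnn n))] /= h.
  exists n; have mSn := (aS n).1.
  have finS := fin_num_measure m _ mSn.
  rewrite measureD// ?ltey_eq ?finU//.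
  rewrite (setIidr (SU n)).
  rewrite -(fineK finS) -(fineK finU) -EFinB lte_fin.
  by apply: le_lt_trans h; exact: ler_norm.
have [mS /(_ _ e20)[t tS]] := aS n; exists t.
have mT := measurable_nor_algebra mG t.
apply: (@le_lt_trans _ _ (m ((\bigcup_n F n) `\` S n `|`
    symdiff (S n) (nor_algebra G t)))).
  apply: le_measure; rewrite ?inE.
  - exact: measurable_symdiff.
  - by apply: measurableU; [exact: measurableD|exact: measurable_symdiff].
  - rewrite /symdiff => x /=.
    have := SU n x; have := pselect (S n x).
    have := pselect (nor_algebra G t x).
    tauto.
apply: (le_lt_trans (measureU2 _ _ _)).
- exact: measurableD.
- exact: measurable_symdiff.
by rewrite (splitr e) EFinD lteD.
Qed.

Lemma nor_algebra_dense A : <<s range G >> A ->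
  forall e : R, (0 < e)%R -> exists t, m (symdiff A (nor_algebra G t)) < e%:E.
Proof.
suff : <<s range G >> `<=` approx by move=> h /h[].
apply: smallest_sub.
  split => [|B aB|F aF]; [exact: approx0| |exact: approx_bigcup].
  by rewrite setTD; exact: approxC.
move=> _ [n _ <-]; split => // e e0; exists (GenTree.Leaf n) => /=.
by rewrite /symdiff setDv setU0 measure0.
Qed.

End approximation.

Lemma countably_generated_approximating (G : nat -> set X) :
  (forall n, measurable (G n)) ->
  (forall A, measurable A -> <<s range G >> A) ->
  exists B : nat -> set X, approximating B.
Proof.
move=> mG sG.
(* The trees are listed by their codes; a number that codes no tree yields the empty set. *)
exists (fun n => if unpickle n is Some t then nor_algebra G t else set0); split.
  by move=> n; case: unpickle => // t; exact: measurable_nor_algebra.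
move=> m A /sG sA e e0; have [t tA] := nor_algebra_dense m mG sA e0.
by exists (pickle t); rewrite pickleK.
Qed.

(** The maximum of 0 and the first [n] terms, [u n] excluded. The initial 0 stands for the value at
    the empty set and keeps the maxima nonnegative. *)
Fixpoint running_max (u : nat -> \bar R) n : \bar R :=
  if n is n'.+1 then maxe (running_max u n') (u n') else 0.

Lemma running_max_ge0 u n : 0 <= running_max u n.
Proof. by elim: n => //= n ih; rewrite le_max ih. Qed.

Lemma running_max_le u (M : \bar R) : 0 <= M -> (forall n, u n <= M) ->
  forall n, running_max u n <= M.
Proof. by move=> M0 uM; elim => //= n ih; rewrite ge_max ih uM. Qed.

Lemma mpos_ge0 mu A : fsm mu -> 0 <= mpos mu A.
Proof. by move=> fmu; have [m1 [_ [-> _ _]]] := fsm_jordan fmu. Qed.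

(** The running maxima increase, so they converge to their supremum. That supremum is [mpos mu A]
    because the value at any measurable subset [C] of [A] is matched, up to [e], by the value at the
    trace of some [B n] on [A]. *)
Lemma cvg_mpos mu (B : nat -> set X) A : fsm mu -> approximating B ->
  measurable A ->
  running_max (fun n => mu (A `&` B n)) n @[n --> \oo] --> mpos mu A.
Proof.
move=> fmu [mB aB] mA; set u := running_max _.
have -> : mpos mu A = ereal_sup (range u).
  apply/eqP; rewrite eq_le; apply/andP; split; last first.
    apply: ge_ereal_sup => _ [n _ <-]; apply: running_max_le.
      exact: mpos_ge0.
    by move=> i; apply: mpos_ubound => //; exact: measurableI.
  have [p [q [_ _ muE]]] := fsm_jordan fmu.
  rewrite mpos_measurable//; apply: ge_ereal_sup => _ [C [mC CA] <-].
  apply/lee_addgt0Pr => e e0.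
  (* Approximating [C] in the total variation [p + q] controls both Jordan parts at once. *)
  have [m mE] := finite_measure_add p q.
  have [n nC] := aB m _ mC _ e0.
  have un : mu (A `&` B n) <= ereal_sup (range u).
    apply: (@le_trans _ _ (u n.+1)); last by apply: ereal_sup_ubound; exists n.+1.
    by rewrite /u /= le_max lexx orbT.
  apply: (@le_trans _ _ (mu (A `&` B n) + e%:E)); last exact: leeD.
  have mAB : measurable (A `&` B n) by exact: measurableI.
  have mD := measurable_symdiff mC (mB n).
  (* Since [C] lies in [A], the sets [C] and [A] cut by [B n] differ only inside the symmetric
     difference of [C] and [B n]. The lower bound is used for [p], the upper bound for [q]. *)
  have h1 : p C <= p (A `&` B n) + p (symdiff C (B n)).
    apply: le_trans (measureU2 _ mAB mD); apply: le_measure; rewrite ?inE//.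
      exact: measurableU.
    rewrite /symdiff => x /= Cx; have := CA x Cx; have := pselect (B n x); tauto.
  have h2 : q (A `&` B n) <= q C + q (symdiff C (B n)).
    apply: le_trans (measureU2 _ mC mD); apply: le_measure; rewrite ?inE//.
      exact: measurableU.
    rewrite /symdiff => x /=; have := pselect (C x); tauto.
  move: nC h1 h2; rewrite mE !muE//.
  have [a1 ->] := fin_numEX (fin_num_measure p _ mC).
  have [a2 ->] := fin_numEX (fin_num_measure q _ mC).
  have [b1 ->] := fin_numEX (fin_num_measure p _ mAB).
  have [b2 ->] := fin_numEX (fin_num_measure q _ mAB).
  have [c1 ->] := fin_numEX (fin_num_measure p _ mD).
  have [c2 ->] := fin_numEX (fin_num_measure q _ mD).
  rewrite -!EFinD !lee_fin lte_fin; lra.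
apply: ereal_nondecreasing_cvgn; apply/nondecreasing_seqP => n /=.
by rewrite le_max lexx.
Qed.

End countably_generated.

(** * Suprema of kernel operators *)

Section supremum.
Context d (X : measurableType d) (R : realType).
Local Open Scope ereal_scope.
Implicit Types (mu : set X -> \bar R) (A B E : set X) (f g : X -> \bar R).
Implicit Types (k : X -> set X -> \bar R) (S T Q : op X R).

Definition kernel_diff k1 k2 : X -> set X -> \bar R :=
  fun x => madd (k1 x) (mopp (k2 x)).

(** The lattice identity that writes the supremum of [a] and [b] as [b + (a - b)^+], applied to the
    measures at each [x]. *)
Definition kernel_sup k1 k2 : X -> set X -> \bar R :=
  fun x => madd (k2 x) (kpos (kernel_diff k1 k2) x).

Lemma fsm_kernel_diff k1 k2 x : fsm (k1 x) -> fsm (k2 x) ->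
  fsm (kernel_diff k1 k2 x).
Proof. by move=> fk1 fk2; apply: fsm_madd => //; exact: fsm_mopp. Qed.

Lemma measurable_kernel_diff k1 k2 A : bounded_kernel k1 -> bounded_kernel k2 ->
  measurable A -> measurable_fun setT (fun x => kernel_diff k1 k2 x A).
Proof.
move=> [_ mk1 _] [_ mk2 _] mA; apply: emeasurable_funD; first exact: mk1.
by apply: measurableT_comp => //; exact: mk2.
Qed.

Lemma measurable_running_max (u : nat -> X -> \bar R) n :
  (forall i, measurable_fun setT (u i)) ->
  measurable_fun setT (fun x => running_max (u ^~ x) n).
Proof.
move=> mu_; elim: n => [|n ih] /=; first exact: measurable_cst.
by apply: measurable_maxe.
Qed.

Lemma bounded_kernel_sup (B : nat -> set X) k1 k2 : approximating R B ->
  bounded_kernel k1 -> bounded_kernel k2 -> bounded_kernel (kernel_sup k1 k2).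
Proof.
move=> aB bk1 bk2; have [M1 k1M] := bounded_kernel_le bk1.
have [M2 k2M] := bounded_kernel_le bk2.
have [fk1 mk1 _] := bk1; have [fk2 mk2 _] := bk2.
have fd x := fsm_kernel_diff (fk1 x) (fk2 x).
(* [M2] bounds [k2], and [M1 + M2] bounds [k1 - k2], hence also its positive part. *)
apply: (@bounded_kernel_intro _ _ _ _ (M2 + (M1 + M2))).
- by move=> x; apply: fsm_madd => //; exact: fsm_mpos.
- move=> A mA; apply: emeasurable_funD; first exact: mk2.
  (* The supremum in [mpos] runs over possibly uncountably many sets; measurability in [x] comes
     from the pointwise limit of maxima of finitely many measurable functions. *)
  apply: (emeasurable_fun_cvg
    (fun n x => running_max (fun i => kernel_diff k1 k2 x (A `&` B i)) n)).
  + move=> n; apply: measurable_running_max => i.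
    by apply: measurable_kernel_diff => //; apply: measurableI => //; exact: aB.1.
  + by move=> x _; exact: cvg_mpos.
- move=> x A mA; rewrite EFinD; apply: (le_trans (lee_abs_add _ _)).
  apply: leeD; first exact: k2M.
  rewrite gee0_abs; last exact: mpos_ge0.
  rewrite /kpos mpos_measurable//; apply: ge_ereal_sup => _ [C [mC _] <-].
  apply: (le_trans (lee_abs _)); apply: (le_trans (lee_abs_add _ _)).
  by rewrite EFinD; apply: leeD; [exact: k1M|rewrite /mopp abseN; exact: k2M].
Qed.

(** The restricted measure does not charge the complement of [E], so [f] and [g] agree almost
    everywhere for it. *)
Lemma sintegral_mrestrict0 mu E f g : positive_measure mu -> measurable E ->
  measurable_fun setT f -> measurable_fun setT g ->
  (forall x, E x -> f x = g x) ->
  Defs.sintegral (mrestrict0 E mu) f = Defs.sintegral (mrestrict0 E mu) g.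
Proof.
move=> pmu mE mf mg fg; have pE := positive_mrestrict0 mE pmu.
have [m mrE] := positive_measureP pE.
have mEC : m (~` E) = 0.
  rewrite -mrE mrestrict0E; last exact: measurableC.
  by rewrite setICl; have [m' ->] := positive_measureP pmu; rewrite measure0.
rewrite mrE !sintegral_positive//; [|by rewrite -mrE..].
apply: ae_eq_integral => //; exists (~` E); split => //.
  exact: measurableC.
by move=> x /= h Ex; apply: h => _; exact: fg.
Qed.

Lemma le_sintegral mu f g (M N : R) : positive_measure mu ->
  measurable_fun setT f -> (forall x, `|f x| <= M%:E) ->
  measurable_fun setT g -> (forall x, `|g x| <= N%:E) ->
  (forall x, f x <= g x) -> Defs.sintegral mu f <= Defs.sintegral mu g.
Proof.
move=> pmu mf fM mg gN fg; have [m mE] := positive_measureP pmu.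
rewrite mE !sintegral_positive//; [|by rewrite -mE..].
apply: le_integral => //.
- exact: bounded_integrable fM.
- exact: bounded_integrable gN.
Qed.

Lemma fsm_setDI mu A B : fsm mu -> measurable A -> measurable B ->
  mu A = mu (A `&` B) + mu (A `\` B).
Proof.
move=> [[nu muE] _] mA mB; rewrite !muE//.
- by rewrite addeC -chargeDI.
- exact: measurableD.
- exact: measurableI.
Qed.

(** The bound is independent of [n] and [x], as dominated convergence demands. *)
Lemma abse_running_max_kernel_le (B : nat -> set X) k1 k2 (M1 M2 : R) A x n :
  (forall A, measurable A -> forall x, `|k1 x A| <= M1%:E) ->
  (forall A, measurable A -> forall x, `|k2 x A| <= M2%:E) ->
  (forall i, measurable (B i)) -> measurable A ->
  `|k2 x A + running_max (fun i => kernel_diff k1 k2 x (A `&` B i)) n|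
    <= (M2 + (M1 + M2))%:E.
Proof.
move=> k1M k2M mB mA.
have mAB i : measurable (A `&` B i) by exact: measurableI.
rewrite EFinD; apply: (le_trans (lee_abs_add _ _)).
apply: leeD; first exact: k2M.
rewrite gee0_abs; last exact: running_max_ge0.
apply: running_max_le.
  rewrite EFinD; apply: adde_ge0.
    exact: le_trans (abse_ge0 _) (k1M _ mA x).
  exact: le_trans (abse_ge0 _) (k2M _ mA x).
move=> i; apply: (le_trans (lee_abs _)); apply: (le_trans (lee_abs_add _ _)).
by rewrite EFinD; apply: leeD; [exact: k1M|rewrite /mopp abseN; exact: k2M].
Qed.

Lemma running_max_kernel_le (B : nat -> set X) T1 T2 Q k1 k2 A :
  approximating R B -> bounded_op Q ->
  weakly_continuous_with T1 k1 -> weakly_continuous_with T2 k2 ->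
  op_le T1 Q -> op_le T2 Q -> measurable A -> forall n mu, positive_measure mu ->
  Defs.sintegral mu (fun x => k2 x A +
    running_max (fun i => kernel_diff k1 k2 x (A `&` B i)) n) <= Q mu A.
Proof.
move=> aB [Qfsm QD _ _] [bk1 T1E] [bk2 T2E] T1Q T2Q mA.
have [M1 k1M] := bounded_kernel_le bk1; have [M2 k2M] := bounded_kernel_le bk2.
have [fk1 mk1 _] := bk1; have [fk2 mk2 _] := bk2.
pose D i x := kernel_diff k1 k2 x (A `&` B i).
have mAI i : measurable (A `&` B i) by apply: measurableI => //; exact: aB.1.
have mAD i : measurable (A `\` B i) by apply: measurableD => //; exact: aB.1.
have mD i : measurable_fun setT (D i) by exact: measurable_kernel_diff.
pose g n x := running_max (D ^~ x) n.
have mg n : measurable_fun setT (g n) by exact: measurable_running_max.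
have mf n : measurable_fun setT (fun x => k2 x A + g n x).
  by apply: emeasurable_funD; [exact: mk2|exact: mg].
have fM n x : `|k2 x A + g n x| <= (M2 + (M1 + M2))%:E.
  by apply: abse_running_max_kernel_le => //; exact: aB.1.
(* The induction keeps [mu] general, since the hypothesis is applied to a restriction of [mu]. For
   [n = 0] the integrand is [k2 x A], and [T2] lies below [Q]. *)
elim => [|n ih] mu pmu.
  rewrite /=; under [fun x => k2 x A + 0]eq_fun do rewrite adde0.
  by rewrite -(T2E _ _ pmu.1 mA); exact: T2Q.
(* [E] is where the new term beats the old maximum. Off [E] the maximum is unchanged, so the
   induction hypothesis applies to the restriction of [mu] to the complement. *)
pose E := [set x | g n x < D n x].
have mE : measurable E.
  rewrite -[E]setTI; exact: measurable_lte.
have pE := positive_mrestrict0 mE pmu.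
have pEC := positive_mrestrict0 (measurableC mE) pmu.
rewrite -[in leLHS](madd_mrestrict0 mE pmu.1) -[in leRHS](madd_mrestrict0 mE pmu.1).
rewrite (sintegral_madd pE.1 pEC.1 (mf n.+1) (fM n.+1)).
rewrite (QD _ _ pE.1 pEC.1) /madd; apply: leeD; last first.
  rewrite (sintegral_mrestrict0 (g := fun x => k2 x A + g n x) pmu)//; first exact: ih.
  - exact: measurableC.
  - move=> x /= /negP; rewrite -leNgt => gD; congr (_ + _).
    by rewrite /g /=; apply/max_idPl.
(* On [E] the integrand is [k2 x A + (k1 - k2)(x, A & B n)], that is, [k1] on the part of [A] in
   [B n] plus [k2] on the rest. It integrates to a value of [T1] plus a value of [T2], each below
   that of [Q] on its piece of [A]. *)
rewrite (sintegral_mrestrict0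
  (g := (fun x => k1 x (A `&` B n)) \+ (fun x => k2 x (A `\` B n))) pmu)//.
- rewrite (sintegralD pE.1 _ (k1M _ (mAI n)) _ (k2M _ (mAD n))); [|exact: mk1|exact: mk2].
  rewrite -(T1E _ _ pE.1)// -(T2E _ _ pE.1)//.
  rewrite (@fsm_setDI (Q _) A (B n))//; [|exact: Qfsm pE.1|exact: aB.1].
  by apply: leeD; [exact: T1Q|exact: T2Q].
- by apply: emeasurable_funD; [exact: mk1|exact: mk2].
- move=> x Ex /=; rewrite /g /= (max_idPr _); last exact: ltW.
  rewrite (fsm_setDI (fk2 x) mA (aB.1 n)) /D /kernel_diff /madd /mopp.
  have [a ->] := fin_numEX (fsm_fin_num (A `&` B n) (fk1 x)).
  have [b ->] := fin_numEX (fsm_fin_num (A `&` B n) (fk2 x)).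
  have [c ->] := fin_numEX (fsm_fin_num (A `\` B n) (fk2 x)).
  by rewrite -!EFinD; congr EFin; lra.
Qed.

Theorem kernel_op_sup (B : nat -> set X) T1 T2 k1 k2 : approximating R B ->
  weakly_continuous_with T1 k1 -> weakly_continuous_with T2 k2 ->
  is_op_sup T1 T2 (kernel_op (kernel_sup k1 k2)).
Proof.
move=> aB wT1 wT2; have [bk1 T1E] := wT1; have [bk2 T2E] := wT2.
have [M1 k1M] := bounded_kernel_le bk1; have [M2 k2M] := bounded_kernel_le bk2.
have [fk1 mk1 _] := bk1; have [fk2 mk2 _] := bk2.
have fd x := fsm_kernel_diff (fk1 x) (fk2 x).
have bj := bounded_kernel_sup aB bk1 bk2.
have [J jJ] := bounded_kernel_le bj; have [_ mj _] := bj.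
split; first exact: kernel_op_bounded.
- move=> mu pmu A mA; rewrite kernel_opE// (T1E _ _ pmu.1)//.
  apply: (le_sintegral pmu _ (k1M _ mA) _ (jJ _ mA)); [exact: mk1|exact: mj|].
  (* [k1 = k2 + (k1 - k2)], and a signed measure lies below its positive part. *)
  move=> x; have : kernel_diff k1 k2 x A <= kpos (kernel_diff k1 k2) x A.
    exact: mpos_ubound.
  rewrite /kernel_diff /kernel_sup /madd /mopp leeBlDl//.
  exact: fsm_fin_num.
- move=> mu pmu A mA; rewrite kernel_opE// (T2E _ _ pmu.1)//.
  apply: (le_sintegral pmu _ (k2M _ mA) _ (jJ _ mA)); [exact: mk2|exact: mj|].
  by move=> x; rewrite /kernel_sup /madd leeDl//; exact: mpos_ge0.
move=> Q bQ T1Q T2Q mu pmu A mA; rewrite kernel_opE//.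
(* Leastness: the bound by [Q mu A], valid for every running maximum, passes to the limit. *)
have cvgf : Defs.sintegral mu (fun x => k2 x A +
      running_max (fun i => kernel_diff k1 k2 x (A `&` B i)) n) @[n --> \oo]
    --> Defs.sintegral mu (fun x => kernel_sup k1 k2 x A).
  apply: (cvg_sintegral pmu.1 _ _ (fun n x => abse_running_max_kernel_le x n k1M k2M aB.1 mA)).
  - move=> n; apply: emeasurable_funD; first exact: mk2.
    apply: measurable_running_max => i; apply: measurable_kernel_diff => //.
    by apply: measurableI => //; exact: aB.1.
  - exact: mj.
  - move=> x; apply: cvgeD; [|exact: cvg_cst|exact: cvg_mpos].
    by apply: fin_num_adde_defr; exact: fsm_fin_num.
rewrite -(cvg_lim _ cvgf)//; apply: lime_le; first by apply/cvg_ex; eexists; exact: cvgf.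
by apply: nearW => n; exact: (running_max_kernel_le aB bQ wT1 wT2).
Qed.

End supremum.

(** * Countable bases of Polish spaces, and the conclusion *)

Lemma polish_countable_base (R : realType) (Omega : ptopologicalType) :
  polish_space R Omega -> exists G : nat -> set Omega,
    (forall n, open (G n)) /\
    forall A, open A -> A = \bigcup_(n in [set n | G n `<=` A]) G n.
Proof.
move=> [[D [cD dD]] [dist [dist0 distC distT openE _]]].
have /countable_injP[f finj] := cD.
have open_ball x (r : R) : open [set y | dist x y < r].
  apply/openE => y /= xy; exists (r - dist x y); first by rewrite subr_gt0.
  by move=> z /= yz; have := distT x y z; lra.
(* Balls of radius [1/(j+1)] about points of [D], listed by the code of a pair. As [f] is injective
   on [D], the union has at most one term; it replaces an inverse of [f]. *)
pose G n : set Omega :=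
  if unpickle n is Some (i, j) then
    \bigcup_(c in [set c | D c /\ f c = i]) [set y | dist c y < j.+1%:R^-1 :> R]
  else set0.
have oG n : open (G n).
  rewrite /G; case: unpickle => [[i j]|]; last exact: open0.
  by apply: bigcup_open => c _; exact: open_ball.
exists G; split => // A oA; apply/seteqP; split => [x Ax|x [n /= GA /GA]//].
have [e e0 eA] := (openE A).1 oA x Ax.
(* Half of [e], because a ball of this radius containing [x] must stay within distance [e] of
   [x]. *)
have [j je] : exists j : nat, j.+1%:R^-1 < e / 2 :> R.
  have e20 : 0 < e / 2 by rewrite divr_gt0.
  have [j _ /(_ j (leqnn j)) je] := near_infty_natSinv_lt (PosNum e20).
  by exists j.
have [c [xc Dc]] : [set y | dist x y < j.+1%:R^-1] `&` D !=set0.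
  apply: dD => //; exists x => /=.
  by rewrite (dist0 x x).2// invr_gt0.
exists (pickle (f c, j)) => /=.
  rewrite /G pickleK => y [c' [Dc' fc'] /= c'y]; apply: eA => /=.
  have cE : c' = c by apply: finj => //; rewrite inE.
  move: c'y xc je => /=; rewrite cE => cy xc je.
  by apply: le_lt_trans (distT x c y) _; rewrite (splitr e) ltrD// (lt_trans _ je).
by rewrite /G pickleK; exists c => //=; rewrite distC.
Qed.

Lemma polish_approximating (R : realType) (Omega : ptopologicalType) :
  polish_space R Omega ->
  exists B : nat -> set (borel Omega), approximating R B.
Proof.
move=> /polish_countable_base[G [oG baseG]].
apply: (@countably_generated_approximating _ (borel Omega) R G) => [n|].
  exact: sub_sigma_algebra.
apply: smallest_sub; first exact: smallest_sigma_algebra.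
(* An open set is the union of the [G n] inside it; empty sets in place of the others make this a
   union over all [n], to which closure under countable unions applies. *)
move=> A /baseG ->; rewrite bigcup_mkcond.
have [s0 _ sU] := smallest_sigma_algebra setT (range G).
apply: sU => n; case: ifPn => // _.
by apply: sub_sigma_algebra; exists n.
Qed.

Theorem theorem3p3 (R : realType) (Omega : ptopologicalType) :
  polish_space R Omega ->
  (forall (T : op (borel Omega) R) (k : borel Omega -> set (borel Omega) -> \bar R),
     bounded_op T -> weakly_continuous_with T k ->
     exists P : op (borel Omega) R,
       is_op_pos_part T P /\ weakly_continuous_with P (kpos k)) /\
  (forall T1 T2 : op (borel Omega) R,
     bounded_op T1 -> weakly_continuous T1 ->
     bounded_op T2 -> weakly_continuous T2 ->
     exists P : op (borel Omega) R, is_op_sup T1 T2 P /\ weakly_continuous P).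
Proof.
move=> /polish_approximating[B aB]; split; last first.
  move=> T1 T2 _ [k1 wT1] _ [k2 wT2]; exists (kernel_op (kernel_sup k1 k2)).
  split; first exact: (kernel_op_sup aB).
  exists (kernel_sup k1 k2); apply: kernel_op_weakly_continuous.
  exact: (bounded_kernel_sup aB wT1.1 wT2.1).
move=> T k _ wT.
(* The positive part is the supremum with the zero operator, whose kernel is zero. *)
pose k0 : borel Omega -> set (borel Omega) -> \bar R := fun _ _ => 0%E.
have w0 : weakly_continuous_with (@op_zero _ (borel Omega) R) k0.
  have f0 x : fsm (k0 x).
    by split => //; exists (czero : {charge set (borel Omega) -> \bar R}).
  split.
    apply: (@bounded_kernel_intro _ _ _ _ 0) => //.
    by move=> x A _; rewrite abse0.
  move=> mu A fmu mA; have [p [n [pE nE _]]] := fsm_jordan fmu.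
  by rewrite sintegralE pE nE !integral0_eq// sube0.
have kE : kernel_sup k k0 = kpos k.
  apply/funext => x; apply/funext => A; rewrite /kernel_sup /madd add0e.
  congr (mpos _ A); apply/funext => C.
  by rewrite /kernel_diff /madd /mopp oppe0 adde0.
rewrite -kE; exists (kernel_op (kernel_sup k k0)); split.
  exact: (kernel_op_sup aB).
by apply: kernel_op_weakly_continuous; exact: (bounded_kernel_sup aB wT.1 w0.1).
Qed.
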